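(* Let $K_{n,m}$ be the complete bipartite graph with parts of sizes $n,m\ge 1$. In the edge-distinguishing game (EDGe) played on $K_{n,m}$ (with $\lambda(K_{n,m})$ colors), Player 1 has a winning strategy if $n+m$ is odd, and Player 2 has a winning strategy if $n+m$ is even.
   Context: All graphs are finite and simple. For a positive integer $k$ let $[k]=\{1,\dots,k\}$. A $k$-coloring of a graph $G$ is a map $c:V(G)\to[k]$; it induces the edge coloring $c'(\{u,v\})=\{c(u),c(v)\}$, a 2-element multiset of colors. The coloring $c$ is edge-distinguishing if $c'$ is injective, and $\lambda(G)$ is the least $k$ for which an edge-distinguishing $k$-coloring of $G$ exists. A partial coloring is a map $c:U\to[k]$ with $U\subseteq V(G)$; its partial induced edge coloring is the induced edge coloring on $G[U]$. EDGe on $G$: two players, Player 1 moving first, alternately choose an uncolored vertex and give it a color from $[\lambda(G)]$; a move is legal iff afterwards the partial induced edge coloring of the colored vertices is injective. The player making the last legal move wins. A player has a winning strategy if they can guarantee a win regardless of the opponent's moves. *)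

(* Defs.v *)
From mathcomp Require Import all_boot.

Set Implicit Arguments.
Unset Strict Implicit.
Unset Printing Implicit Defensive.

Record sgraph := SGraph {
  vertex :> finType;
  adj : rel vertex;
  adj_sym : symmetric adj;
  adj_irr : irreflexive adj
}.

(* Injectivity, on the edges of G[U], of the edge coloring induced by c.  The
   edge with ends u, v is the set [set u; v]; its induced color is the
   2-element multiset with elements c u, c v, so that equality of induced
   colors is perm_eq of the lists enumerating them. *)
Definition edge_distinguishing_on (G : sgraph) (C : eqType) (c : G -> C)
    (U : {set G}) : bool :=
  [forall u in U, forall v in U, forall x in U, forall y in U,
     [&& adj u v, adj x y & perm_eq [:: c u; c v] [:: c x; c y]]
       ==> ([set u; v] == [set x; y])].

Definition edge_distinguishing (G : sgraph) (k : nat)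
    (c : {ffun G -> 'I_k}) : bool :=
  edge_distinguishing_on c [set: G].

Definition edge_distinguishable (G : sgraph) (k : nat) : bool :=
  [exists c : {ffun G -> 'I_k}, edge_distinguishing c].

Lemma exists_edge_distinguishable (G : sgraph) :
  exists k, edge_distinguishable G k.
Proof.
exists #|G|; apply/existsP; exists [ffun v => enum_rank v].
apply/'forall_implyP => u _; apply/'forall_implyP => v _.
apply/'forall_implyP => x _; apply/'forall_implyP => y _.
apply/implyP => /and3P[_ _]; rewrite !ffunE => puv.
have {puv}: perm_eq (map enum_rank [:: u; v]) (map enum_rank [:: x; y]) by [].
move=> /(perm_map enum_val); rewrite -!map_comp !(eq_map (@enum_rankK _)) !map_id.
by move=> /perm_mem puv; apply/eqP/setP => z; move: (puv z); rewrite !inE.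
Qed.

Definition lambda (G : sgraph) : nat := ex_minn (exists_edge_distinguishable G).

Section Game.
Variables (G : sgraph) (k : nat).

(* None marks an uncolored vertex. *)
Definition partial_coloring := {ffun G -> option 'I_k}.

Definition colored (c : partial_coloring) : {set G} := [set v | c v != None].

Definition move := (G * 'I_k)%type.

Definition make_move (c : partial_coloring) (mv : move) : partial_coloring :=
  [ffun v => if v == mv.1 then Some mv.2 else c v].

Definition legal (c : partial_coloring) (mv : move) : bool :=
  (mv.1 \notin colored c) &&
  edge_distinguishing_on (make_move c mv) (colored (make_move c mv)).

(* A history lists the moves made so far, earliest first. *)
Definition position (h : seq move) : partial_coloring :=
  foldl make_move [ffun=> None] h.

Inductive play : seq move -> Prop :=
| play_nil : play [::]
| play_rcons h mv : play h -> legal (position h) mv -> play (rcons h mv).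

Definition complete_play (h : seq move) : Prop :=
  play h /\ forall mv, ~~ legal (position h) mv.

Inductive player := Player1 | Player2.

Definition to_move (h : seq move) : player :=
  if odd (size h) then Player2 else Player1.

Definition made_last_move (p : player) (h : seq move) : Prop :=
  exists h' mv, h = rcons h' mv /\ to_move h' = p.

Definition strategy := seq move -> move.

Definition follows (p : player) (s : strategy) (h : seq move) : Prop :=
  forall h' mv, prefix (rcons h' mv) h -> to_move h' = p -> mv = s h'.

(* The first clause forces the strategy to provide a legal move whenever its
   owner is to move and some legal move exists; without it a strategy
   prescribing illegal moves would win vacuously. *)
Definition winning_strategy (p : player) (s : strategy) : Prop :=
  (forall h, play h -> follows p s h -> to_move h = p ->
     (exists mv, legal (position h) mv) -> legal (position h) (s h)) /\
  (forall h, complete_play h -> follows p s h -> made_last_move p h).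

End Game.

Definition EDGe_has_winning_strategy (G : sgraph) (p : player) : Prop :=
  exists s : strategy G (lambda G), winning_strategy p s.

Definition bip_adj (n m : nat) : rel ('I_n + 'I_m) :=
  fun u v => match u, v with
             | inl _, inr _ | inr _, inl _ => true
             | _, _ => false
             end.

Lemma bip_adj_sym (n m : nat) : symmetric (@bip_adj n m).
Proof. by case=> i [] j. Qed.

Lemma bip_adj_irr (n m : nat) : irreflexive (@bip_adj n m).
Proof. by case. Qed.

Definition complete_bipartite (n m : nat) : sgraph :=
  SGraph (@bip_adj_sym n m) (@bip_adj_irr n m).

(* Main.v *)
Require Import Defs.
From mathcomp Require Import all_boot.

Set Implicit Arguments.
Unset Strict Implicit.
Unset Printing Implicit Defensive.

(** Once both parts contain a colored vertex, a partial coloring of [K_{n,m}]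
    is legal iff it is injective on each part and the two parts share at most
    one color.  Hence [lambda >= n + m - 1], and counting colors shows that
    such a position can always be extended until every vertex is colored.  As
    long as one part is untouched the other one may be colored arbitrarily.  So
    a finished game has colored exactly one whole part, or the whole graph.  If
    [n + m] is odd, Player 1 opens in the part of odd size, and both remaining
    possible lengths are odd.  If [n + m] is even, Player 2 answers the first
    move in the other part, which forces the length [n + m]. *)

(** * Plays and strategies on an arbitrary graph *)

Section Plays.
Variables (G : sgraph) (k : nat).
Implicit Types (c : partial_coloring G k) (h : seq (move G k)) (mv : move G k).

Lemma position_rcons h mv :
  position (rcons h mv) = make_move (position h) mv.
Proof. by rewrite /position foldl_rcons. Qed.

Lemma colored_make_move c mv :
  colored (make_move c mv) = mv.1 |: colored c.
Proof. by apply/setP=> v; rewrite !inE ffunE; have [->|_] := eqVneq v mv.1. Qed.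

Lemma colored_nil : colored (position (Nil (move G k))) = set0.
Proof. by apply/setP=> v; rewrite !inE ffunE. Qed.

Lemma mem_colored_position h v :
  (v \in colored (position h)) = (v \in map fst h).
Proof.
elim/last_ind: h => [|h mv IH]; first by rewrite colored_nil inE.
by rewrite position_rcons colored_make_move map_rcons mem_rcons !inE -IH inE.
Qed.

Lemma card_colored_play h : play h -> #|colored (position h)| = size h.
Proof.
elim=> [|{}h mv _ IH /andP[ncol _]]; first by rewrite colored_nil cards0.
by rewrite position_rcons colored_make_move cardsU1 ncol IH size_rcons.
Qed.

Lemma play_edge_distinguishing h : play h ->
  edge_distinguishing_on (position h) (colored (position h)).
Proof.
case=> [|{}h mv _ /andP[_ leg]]; last by rewrite position_rcons.
by rewrite colored_nil; apply/'forall_implyP => u; rewrite inE.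
Qed.

Lemma made_last_moveP (p : player) h : 0 < size h ->
  odd (size h) = (if p is Player1 then true else false) -> made_last_move p h.
Proof.
elim/last_ind: h => // h mv _ _; rewrite size_rcons /= => par.
by exists h, mv; split=> //; rewrite /to_move; case: (odd _) p par => -[].
Qed.

(** Each winning strategy only has to steer one early move, so it is built from a preference: a
    preferred legal move if there is one, else any legal move. [mv0] is a default for positions
    without legal moves. *)
Lemma preferring_strategy (mv0 : move G k)
    (pref : seq (move G k) -> pred (move G k)) :
  exists s : strategy G k, forall h,
    ((exists mv, legal (position h) mv) -> legal (position h) (s h)) /\
    ((exists2 mv, legal (position h) mv & pref h mv) -> pref h (s h)).
Proof.
exists (fun h =>
  if [pick mv | legal (position h) mv && pref h mv] is Some mv then mv else
  if [pick mv | legal (position h) mv] is Some mv then mv else mv0) => h.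
case: pickP => [mv /andP[leg pr]|none] //; split=> [[mv leg]|[mv leg pr]].
  by case: pickP => // /(_ mv); rewrite leg.
by move: (none mv); rewrite leg pr.
Qed.

End Plays.

(** * Distinguishing colorings of a complete bipartite graph, its parts being the fibers of
    [side] *)

Section TwoParts.
Variables (G : sgraph) (side : G -> bool).
Hypothesis adjE : forall u v, adj u v = (side u != side v).

Definition part (b : bool) : {set G} := [set v | side v == b].

Lemma card_parts (b : bool) : #|part b| + #|part (~~ b)| = #|G|.
Proof.
rewrite -(cardsC (part b)); congr (_ + #|pred_of_set _|).
by apply/setP=> v; rewrite !inE; case: (side v) b => -[].
Qed.

Section Colorings.
Variable k : nat.
Implicit Types (c : G -> option 'I_k) (p : {ffun G -> option 'I_k}).

(** The colored vertex [v] lies opposite [u] and [x]: the edges [uv] and [xv] would get the same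
    color. Nothing is required while the opposite part is untouched. *)
Definition part_injective c : Prop :=
  forall u x v i, side u = side x -> side v != side u ->
    c u = Some i -> c x = Some i -> c v != None -> u = x.

(* Two distinct common colors i, j would be taken by u, x in one part and by
   y, v in the other, and the edges uv and xy would both get {i, j}. *)
Definition one_common_color c : Prop :=
  forall u x v y i j, side u = side x -> side v = side y -> side v != side u ->
    c u = Some i -> c y = Some i -> c v = Some j -> c x = Some j -> u = x.

Lemma perm_swap2 (T : eqType) (x y : T) : perm_eq [:: x; y] [:: y; x].
Proof. by rewrite (perm_catC [:: x] [:: y]). Qed.

Lemma perm_eq2P (T : eqType) (a b x y : T) :
  perm_eq [:: a; b] [:: x; y] -> (a = x /\ b = y) \/ (a = y /\ b = x).
Proof.
move=> pab; have: a \in [:: x; y] by rewrite -(perm_mem pab) mem_head.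
rewrite !inE => /orP[] /eqP ea; move: pab; rewrite ea.
  by rewrite perm_cons => /perm_small_eq-/(_ isT)[->]; left.
rewrite (permPr (perm_swap2 x y)) perm_cons.
by move=> /perm_small_eq-/(_ isT)[->]; right.
Qed.

(** Equal edge colors match the ends either within each part, where injectivity identifies them, or
    crosswise, where both colors occur in both parts. *)
Lemma edge_distinguishing_onP p :
  edge_distinguishing_on p (colored p) <-> part_injective p /\ one_common_color p.
Proof.
split=> [ed|[inj one]].
  have {}ed u v x y : p u != None -> p v != None -> p x != None ->
      p y != None -> side u != side v -> side x != side y ->
      perm_eq [:: p u; p v] [:: p x; p y] -> [set u; v] = [set x; y].
    move=> cu cv cx cy suv sxy pe; apply/eqP.
    move/'forall_implyP: ed => /(_ u); rewrite inE => /(_ cu).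
    move/'forall_implyP => /(_ v); rewrite inE => /(_ cv).
    move/'forall_implyP => /(_ x); rewrite inE => /(_ cx).
    move/'forall_implyP => /(_ y); rewrite inE => /(_ cy) /implyP.
    by apply; rewrite !adjE suv sxy pe.
  have eq1 u v x y : side u = side x -> side v != side u ->
      [set u; v] = [set x; y] -> u = x.
    move=> sux svu /setP e; have := e x; rewrite !inE eqxx => /orP[/eqP->//|].
    by move=> /eqP exv; move: svu; rewrite sux exv eqxx.
  split=> [u x v i sux svu cu cx cv|u x v y i j sux svy svu cu cy cv cx].
    apply: (eq1 u v x v) => //; apply: ed; rewrite ?cu ?cx //.
    - by rewrite eq_sym.
    - by rewrite -sux eq_sym.
  apply: (eq1 u v x y) => //; apply: ed; rewrite ?cu ?cx ?cv ?cy //.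
  - by rewrite eq_sym.
  - by rewrite -sux -svy eq_sym.
  - exact: perm_swap2.
have aligned u v x y : p u != None -> p v != None -> p x != None ->
    p y != None -> side u = side x -> side v = side y -> side v != side u ->
    perm_eq [:: p u; p v] [:: p x; p y] -> [set u; v] = [set x; y].
  case cu: (p u) => [i|] // _; case cv: (p v) => [j|] // _ cx cy sux svy svu.
  case/perm_eq2P => -[/esym px /esym py].
    rewrite (inj u x v i) ?cv // (inj v y u j) ?cu // -?svy 1?eq_sym //.
  rewrite (one u x v y i j) // (one v y u x j i) //.
  by rewrite eq_sym.
apply/'forall_implyP => u; rewrite inE => cu.
apply/'forall_implyP => v; rewrite inE => cv.
apply/'forall_implyP => x; rewrite inE => cx.
apply/'forall_implyP => y; rewrite inE => cy.
rewrite !adjE; apply/implyP => /and3P[suv sxy pe]; apply/eqP.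
have [sux|sux] := eqVneq (side u) (side x).
  apply: aligned => //; last by rewrite eq_sym.
  by move: suv sxy; rewrite sux; case: (side v) (side x) (side y) => -[] [].
(* With [u] and [x] in opposite parts, exchanging the ends of the second edge aligns it with the
   first. *)
rewrite (setUC [set x]); apply: aligned => //.
- by move: sux sxy; case: (side u) (side x) (side y) => -[] [].
- by move: sux suv; case: (side v) (side x) (side u) => -[] [].
- by rewrite eq_sym.
- exact: perm_trans pe (perm_swap2 _ _).
Qed.

Definition part_colors c (b : bool) : {set 'I_k} :=
  [set i | [exists v, (side v == b) && (c v == Some i)]].

Lemma part_colorsP c b i :
  reflect (exists2 v, side v = b & c v = Some i) (i \in part_colors c b).
Proof.
rewrite inE; apply: (iffP existsP) => [[v /andP[/eqP ? /eqP ?]]|[v sv cv]].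
  by exists v.
by exists v; rewrite sv cv !eqxx.
Qed.

Lemma card_part_colors p b : #|part_colors p b| <= #|part b :&: colored p|.
Proof.
rewrite -(card_imset (part_colors p b) (@Some_inj _)).
apply: leq_trans (leq_imset_card p _); apply: subset_leq_card.
apply/subsetP=> _ /imsetP[i /part_colorsP[v sv cv] ->].
by apply/imsetP; exists v; rewrite // !inE sv cv eqxx.
Qed.

Lemma card_part_colors_lt p v : v \notin colored p ->
  #|part_colors p (side v)| < #|part (side v)|.
Proof.
move=> ncv; apply: leq_ltn_trans (card_part_colors _ _) _.
apply/proper_card/properP; split; first exact: subsetIl.
by exists v; rewrite !inE ?eqxx //; rewrite inE in ncv.
Qed.

End Colorings.

(** Both parts being inhabited, a distinguishing coloring is injective on each, and their color sets
    share at most one color; inclusion-exclusion gives the bound. *)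
Lemma card_le_lambda (u v : G) : side u != side v -> #|G| <= (lambda G).+1.
Proof.
move=> suv; rewrite /lambda; case: ex_minnP => k /existsP[c ed] _.
pose p : {ffun G -> option 'I_k} := [ffun v => Some (c v)].
have colp : colored p = setT by apply/setP=> x; rewrite !inE ffunE.
have /edge_distinguishing_onP[inj one] : edge_distinguishing_on p (colored p).
  rewrite colp; move: ed; rewrite /edge_distinguishing => /'forall_implyP ed.
  apply/'forall_implyP => u1 U1; move/'forall_implyP: (ed u1 U1) => {}ed.
  apply/'forall_implyP => v1 V1; move/'forall_implyP: (ed v1 V1) => {}ed.
  apply/'forall_implyP => x1 X1; move/'forall_implyP: (ed x1 X1) => {}ed.
  apply/'forall_implyP => y1 Y1; move/implyP: (ed y1 Y1) => {}ed.
  apply/implyP => /and3P[a1 a2 pe]; apply: ed; rewrite a1 a2 /=.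
  rewrite !ffunE in pe.
  by case/perm_eq2P: pe => -[[->] [->]] //; apply: perm_swap2.
have other b : exists x, side x = ~~ b.
  by move: suv; case su: (side u); case sv: (side v) => // _; case: b;
    (by exists u) || (by exists v).
have injb b : {in part b &, injective c}.
  move=> x y; rewrite !inE => /eqP sx /eqP sy cxy; have [z sz] := other b.
  apply: (inj x y z (c x)); rewrite ?ffunE ?sx ?sy ?sz ?cxy //.
  by case: b {sx sy sz}.
rewrite -(card_parts true) -(card_in_imset (injb true)).
rewrite -(card_in_imset (injb (~~ true))) -cardsUI -addn1 leq_add //.
  by rewrite -[X in _ <= X]card_ord max_card.
(* Preimages of two common colors in both parts form the configuration excluded by [one]. *)
apply/card_le1_eqP => i j; rewrite !inE.
case/andP=> /imsetP[x1 sx1 ei] /imsetP[x2 sx2 ei'].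
case/andP=> /imsetP[y1 sy1 ej] /imsetP[y2 sy2 ej'].
move: sx1 sx2 sy1 sy2; rewrite !inE => /eqP sx1 /eqP sx2 /eqP sy1 /eqP sy2.
rewrite ei ej; suff -> : x1 = y1 by [].
by apply: (one x1 y1 y2 x2 i j);
  rewrite ?sx1 ?sy1 ?sx2 ?sy2 // ffunE -?ei -?ej -?ei' -?ej'.
Qed.

(** * Legal moves and positions without any *)

Section Legality.
Variable k : nat.
Implicit Types (p : partial_coloring G k) (i : 'I_k).

(** After the move no edge joins two colored vertices, so both conditions hold vacuously. *)
Lemma legal_untouched p v i : v \notin colored p ->
  (forall x, side x != side v -> p x = None) -> legal p (v, i).
Proof.
move=> ncv untouched; rewrite /legal ncv /=.
have mono x : make_move p (v, i) x != None -> side x = side v.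
  rewrite ffunE /=; have [->//|_] := eqVneq x v => cx; apply/eqP.
  by apply: contraNT cx => /untouched/eqP.
apply/edge_distinguishing_onP; split=> [u x w j sux swu cu cx cw|].
  by move: swu; rewrite (mono w) // (mono u) ?cu // eqxx.
move=> u x w y j l sux swy swu cu cy cw cx.
by move: swu; rewrite (mono w) ?cw // (mono u) ?cu // eqxx.
Qed.

Lemma legal_second_move p u v i : colored p = [set u] -> side v != side u ->
  legal p (v, i).
Proof.
move=> colp svu; have nuv : v != u by apply: contraNneq svu => ->.
have only x y : make_move p (v, i) x != None ->
    make_move p (v, i) y != None -> side x = side y -> x = y.
  have mem z : make_move p (v, i) z != None -> (z == v) || (z == u).
    move=> cz; have : z \in colored (make_move p (v, i)) by rewrite inE.
    by rewrite colored_make_move colp !inE.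
  move=> /mem/orP[] /eqP-> /mem/orP[] /eqP-> // sxy.
    by rewrite sxy eqxx in svu.
  by rewrite sxy eqxx in svu.
rewrite /legal colp inE nuv /=; apply/edge_distinguishing_onP; split.
  by move=> w x ? ? sw _ cw cx _; apply: only; rewrite ?cw ?cx.
by move=> w x ? ? ? ? sw _ _ cw _ _ cx; apply: only; rewrite ?cw ?cx.
Qed.

(** A color new to the part of [v] keeps that part injective, and it either leaves the common colors
    unchanged or becomes the only one. The colored vertex [w] beside [v] ensures that the opposite
    part is already injective in [p]. *)
Lemma legal_fresh_color p v w i :
    edge_distinguishing_on p (colored p) ->
    v \notin colored p -> w \in colored p -> side w = side v ->
    i \notin part_colors p (side v) ->
    (i \in part_colors p (~~ side v) ->
       part_colors p (side v) :&: part_colors p (~~ side v) = set0) ->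
  legal p (v, i).
Proof.
move=> /edge_distinguishing_onP[inj one] ncv cw sw iA iB.
rewrite /legal ncv /=; set q := make_move p (v, i).
have qv : q v = Some i by rewrite ffunE eqxx.
have qE x : x != v -> q x = p x by rewrite ffunE /= => /negPf->.
have neq x : side x != side v -> x != v by apply: contraNneq => ->.
have newA x : x != v -> side x = side v -> q x = Some i -> False.
  move=> nx sx; rewrite qE // => cx; move/negP: iA; apply.
  by apply/part_colorsP; exists x.
(* If the new color occurs opposite at [z], then [iB] leaves no color [l] common to another vertex
   [x] beside [v] and an opposite vertex [y]. *)
have noshare z x y l : side z != side v -> q z = Some i ->
    side y != side v -> q y = Some l ->
    x != v -> side x = side v -> q x = Some l -> False.
  have oth b : b != side v -> b = ~~ side v by case: b (side v) => -[].
  move=> sz cz sy cy nx sx cx.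
  rewrite qE ?neq // in cz; rewrite qE ?neq // in cy; rewrite qE // in cx.
  have /iB/setP/(_ l) : i \in part_colors p (~~ side v).
    by apply/part_colorsP; exists z => //; apply: oth.
  rewrite !inE => /andP[]; split; apply/existsP.
    by exists x; rewrite sx cx !eqxx.
  by exists y; rewrite (oth _ sy) cy !eqxx.
have injq : part_injective q.
  move=> u x y j sux syu cu cx cy.
  have [eu|nu] := eqVneq u v; have [ex|nx] := eqVneq x v.
  - by rewrite eu ex.
  - by case: (newA x); rewrite -?sux ?eu // cx -cu eu qv.
  - by case: (newA u); rewrite ?sux ?ex // cu -cx ex qv.
  rewrite !qE // in cu cx.
  have [ey|ny] := eqVneq y v; last by apply: (inj u x y j) => //; rewrite -qE.
  by apply: (inj u x w j) => //; [rewrite sw -ey | rewrite inE in cw].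
apply/edge_distinguishing_onP; split=> // u x y z j l sux syz syu cu cz cy cx.
(* Once [y = z] and [u = x] are settled, [v] is at most one of the four vertices. If it is one,
   [noshare] applies; otherwise the condition is inherited from [p]. *)
have [eyz|nyz] := eqVneq y z.
  apply: (injq u x y j) => //; last by rewrite cy.
  by rewrite cx -cy eyz.
have [//|nux] := eqVneq u x.
have [su|su] := eqVneq (side u) (side v).
  have sy : side y != side v by rewrite -su.
  have sz : side z != side v by rewrite -syz.
  have [eu|nu] := eqVneq u v.
    case: (@noshare z x y l) => //; first by rewrite cz -cu eu qv.
      by rewrite -eu eq_sym.
    by rewrite -sux.
  have [ex|nx] := eqVneq x v.
    by case: (@noshare y u z j) => //; rewrite cy -cx ex qv.
  by apply: (one u x y z j l); rewrite // -qE // neq.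
have sy : side y = side v by case: (side y) (side u) (side v) syu su => -[] [].
have sx : side x != side v by rewrite -sux.
have [ey|ny] := eqVneq y v.
  case: (@noshare x z u j) => //; first by rewrite cx -cy ey qv.
    by rewrite -ey eq_sym.
  by rewrite -syz.
have [ez|nz] := eqVneq z v.
  by case: (@noshare u y x l) => //; rewrite cu -cz ez qv.
by apply: (one u x y z j l); rewrite // -qE // neq.
Qed.

(** The conclusion is what [legal_fresh_color] asks of a color. As [v] is uncolored, its part shows
    fewer colors than it has vertices, which leaves room for one more. *)
Lemma fresh_color_exists p v w : #|G| <= k.+1 ->
    v \notin colored p -> w \in colored p -> side w != side v ->
  exists2 i, i \notin part_colors p (side v) &
    (i \in part_colors p (~~ side v) ->
       part_colors p (side v) :&: part_colors p (~~ side v) = set0).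
Proof.
move=> kG ncv cw sw.
have ltA := card_part_colors_lt ncv.
have leB : #|part_colors p (~~ side v)| <= #|part (~~ side v)|.
  exact: leq_trans (card_part_colors _ _) (subset_leq_card (subsetIl _ _)).
have Bgt0 : 0 < #|part (~~ side v)|.
  apply/card_gt0P; exists w; rewrite inE.
  by case: (side w) (side v) sw => -[].
have Gk := card_parts (side v).
have outside (A : {set 'I_k}) : #|A| < k -> exists i, i \notin A.
  move=> ltk; have /card_gt0P[i] : 0 < #|~: A|.
    by rewrite cardsCs setCK card_ord subn_gt0.
  by rewrite inE; exists i.
(* Without a common color, any color missing from the part of [v] will do, even one used
   opposite. *)
have [e0|/set0Pn[j jAB]] :=
  eqVneq (part_colors p (side v) :&: part_colors p (~~ side v)) set0.
  have [|i iA] := outside (part_colors p (side v)); last by exists i.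
  apply: leq_trans ltA _; rewrite -ltnS; apply: leq_trans kG.
  by rewrite -Gk -addn1 leq_add2l.
(* Now the color must be absent from both parts. At most [#|G| - 2] colors are in use: one is saved
   by [v], one by the common color [j]. *)
have [|i] := outside (part_colors p (side v) :|: part_colors p (~~ side v)).
  have AB1 : 0 < #|part_colors p (side v) :&: part_colors p (~~ side v)|.
    by apply/card_gt0P; exists j.
  rewrite -ltnS; apply: leq_trans kG; rewrite -Gk.
  apply: leq_trans (leq_add ltA leB); rewrite addSn -cardsUI ltnS.
  by rewrite -addn1 leq_add2l.
by rewrite inE negb_or => /andP[iA iB]; exists i => // /(negP iB).
Qed.

Lemma colored_of_no_legal_move p (i0 : 'I_k) : #|G| <= k.+1 ->
    edge_distinguishing_on p (colored p) -> (forall mv, ~~ legal p mv) ->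
  colored p = setT \/ exists b, colored p = part b.
Proof.
move=> kG ed stuck.
have [/eqP->|] := boolP (colored p == setT); first by left.
rewrite eqEsubset subsetT /= => /subsetPn[v _ ncv]; right; exists (~~ side v).
(* Were the opposite part untouched, [v] could take any color. *)
have [w sw cw] : exists2 w, side w != side v & w \in colored p.
  have [/exists_inP[w ? ?]|/exists_inPn none] :=
    boolP [exists (w | w \in colored p), side w != side v]; first by exists w.
  case/negP: (stuck (v, i0)); apply: legal_untouched => // x sx.
  apply/eqP; apply: contraTT sx => cx.
  by apply: (none x); rewrite inE.
(* A colored vertex beside [v] would make some fresh color legal at [v]. *)
have untouched x : side x = side v -> p x = None.
  move=> sx; apply/eqP; apply: contraT => cx.
  have [i iA iB] := fresh_color_exists kG ncv cw sw.
  case/negP: (stuck (v, i)).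
  by apply: (@legal_fresh_color _ _ x) => //; rewrite inE.
apply/setP=> x; rewrite !inE.
have [sx|sx] := eqVneq (side x) (side v).
  by rewrite untouched // sx; case: (side v).
have -> : side x == ~~ side v by case: (side x) (side v) sx => -[].
(* The part of [v] being untouched, an uncolored opposite vertex could take any color. *)
apply: contraT => ncx; case/negP: (stuck (x, i0)).
apply: legal_untouched => [|y sy]; first by rewrite inE.
by apply: untouched; case: (side x) (side y) (side v) sx sy => -[] [].
Qed.

End Legality.

(** * Winning strategies for the two parities *)

Section Game.
Variables (u0 v0 : G).
Hypothesis (su0 : side u0 = true) (sv0 : side v0 = false).

Let k := lambda G.

Lemma card_le_lambda_parts : #|G| <= k.+1.
Proof. by apply: (@card_le_lambda u0 v0); rewrite su0 sv0. Qed.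

Lemma part_inhabited b : exists v, side v = b.
Proof. by case: b; [exists u0 | exists v0]. Qed.

Lemma lambda_parts_gt0 : 0 < k.
Proof.
rewrite -ltnS; apply: leq_trans card_le_lambda_parts.
apply/card_gt1P; exists u0, v0; split=> //.
by apply/eqP=> e; move: su0; rewrite e sv0.
Qed.

Let i0 : 'I_k := Ordinal lambda_parts_gt0.

Lemma legal_first_move v i : legal (position (Nil (move G k))) (v, i).
Proof.
apply: legal_untouched => [|x _]; first by rewrite colored_nil inE.
by rewrite ffunE.
Qed.

Lemma size_complete_play (h : seq (move G k)) : complete_play h ->
  size h = #|G| \/
  exists2 b, size h = #|part b| & {in h, forall mv, side mv.1 = b}.
Proof.
move=> [pl stuck]; rewrite -(card_colored_play pl).
have [->|[b cb]] := colored_of_no_legal_move i0 card_le_lambda_parts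
                      (play_edge_distinguishing pl) stuck.
  by left; rewrite cardsT.
right; exists b => [|mv mvh]; first by rewrite cb.
have := map_f fst mvh; rewrite -mem_colored_position cb inE.
by move/eqP.
Qed.

Lemma complete_play_gt0 (h : seq (move G k)) : complete_play h -> 0 < size h.
Proof. by case: h => // -[_ /(_ (u0, i0))]; rewrite legal_first_move. Qed.

Lemma player1_wins : odd #|G| -> EDGe_has_winning_strategy G Player1.
Proof.
move=> oddG.
have [b oddb] : exists b, odd #|part b|.
  move: oddG; rewrite -(card_parts true) oddD.
  by case: (boolP (odd #|part true|)) => [? _|_ ?]; [exists true | exists false].
have [s sP] := preferring_strategy (u0, i0)
  (fun (h : seq (move G k)) mv => side mv.1 == b).
exists s; split=> [h _ _ _ /(sP h).1 //|h ch fol].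
have sz := complete_play_gt0 ch; apply: made_last_moveP => //.
case: (size_complete_play ch) => [->//|[b' -> inb]].
case: h sz fol {ch} inb => // mv h _ fol inb.
(* The preference puts the first move in part [b], so a play confined to one part fills [b], whose
   size is odd. *)
have emv : mv = s [::] by apply: fol; rewrite //= eqxx prefix0s.
rewrite -(inb mv (mem_head _ _)) emv.
have /(sP [::]).2/eqP-> // : exists2 mv : move G k,
  legal (position [::]) mv & side mv.1 == b.
have [v sv] := part_inhabited b.
by exists (v, i0); [apply: legal_first_move | rewrite /= sv].
Qed.

Lemma player2_wins : ~~ odd #|G| -> EDGe_has_winning_strategy G Player2.
Proof.
move=> evG.
have [s sP] := preferring_strategy (u0, i0)
  (fun (h : seq (move G k)) mv =>
     (* The value [true] concerns the empty history, where Player 2 is not to move. *)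
     if h is mv1 :: _ then side mv.1 != side mv1.1 else true).
exists s; split=> [h _ _ _ /(sP h).1 //|h ch fol].
have sz := complete_play_gt0 ch; apply: made_last_moveP => //; apply/negbTE.
case: (size_complete_play ch) => [->//|[b szb inb]].
case: h sz fol ch szb inb => // mv1 h _ fol ch _ inb.
(* A play confined to one part is impossible: a legal answer opposite the first move exists, so the
   play continues and [s] answers there. *)
have answer : exists2 mv : move G k, legal (position [:: mv1]) mv &
    side mv.1 != side mv1.1.
  have [v sv] := part_inhabited (~~ side mv1.1).
  exists (v, i0); last by rewrite sv; case: (side _).
  apply: (@legal_second_move _ _ mv1.1); last by rewrite sv; case: (side _).
  by apply/setP=> x; rewrite mem_colored_position !inE.
case: h fol ch inb => [|mv2 h] fol ch inb.
  by case: answer => mv leg _; case: ch => _ /(_ mv); rewrite leg.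
have emv : mv2 = s [:: mv1] by apply: fol; rewrite //= !eqxx prefix0s.
have := (sP [:: mv1]).2 answer; rewrite -emv.
by rewrite (inb mv1) ?(inb mv2) ?eqxx // !inE eqxx ?orbT.
Qed.

End Game.
End TwoParts.

Theorem theorem3p3 (n m : nat) (hn : 1 <= n) (hm : 1 <= m) :
  (odd (n + m) ->
     EDGe_has_winning_strategy (complete_bipartite n m) Player1) /\
  (~~ odd (n + m) ->
     EDGe_has_winning_strategy (complete_bipartite n m) Player2).
Proof.
pose side (v : complete_bipartite n m) := if v is inl _ then true else false.
have adjE (u v : complete_bipartite n m) : adj u v = (side u != side v).
  by case: u => ?; case: v.
have <- : #|complete_bipartite n m| = n + m by rewrite card_sum !card_ord.
pose u0 : complete_bipartite n m := inl (Ordinal hn).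
pose v0 : complete_bipartite n m := inr (Ordinal hm).
by split; [apply: (@player1_wins _ side adjE u0 v0)
          | apply: (@player2_wins _ side adjE u0 v0)].
Qed.
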